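(* There exist oriented knot diagrams $D$ and $E$ in the $2$-sphere such that $E$ is obtained from $D$ by a single RIII move, $iu_{(+1)}(D)=iu_{(+1)}(E)$, and $iu_{(-1)}(D)\neq iu_{(-1)}(E)$.
   Context: Knot diagrams are oriented and lie in the $2$-sphere. An RIII move is a Reidemeister move of type III. For a crossing $x$, $\mathrm{sign}(x)\in\{\pm1\}$ is the usual sign. Smoothings: at a crossing $x$ of an oriented diagram $D$, cut the knot at the two preimage points of $x$, and paste the four short subarcs near the resulting endpoints in a way other than the original one. If the pasting connects orientations consistently this is the (regular) smoothing, and $D_x$ denotes the link represented by the resulting diagram (a $2$-component link when $D$ is a knot diagram). If the pasting connects orientations inconsistently this is the irregular smoothing, and $\check{D_x}$ denotes the unoriented link represented by the resulting diagram (a knot when $D$ is a knot diagram). Unknotting number: for an $m$-component link $K$, $u(K)$ is the minimum number of crossing changes in a sequence of Reidemeister moves and crossing changes (at any crossings, between the same or distinct components) deforming a diagram of $K$ into a diagram of the trivial $m$-component link (the link bounding a disjoint union of $m$ disks). Invariants: for a diagram $D$ of a knot $K$, $$iu_{(+1)}(D)=\sum_{x}\mathrm{sign}(x)\,|u(D_x)-u(K)|,\qquad iu_{(-1)}(D)=\sum_{x}\mathrm{sign}(x)\,|u(\check{D_x})-u(K)|,$$ where $x$ runs over all crossings of $D$ (empty sums are $0$). *)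

(* Defs.v *)
From mathcomp Require Import all_boot all_order all_algebra.
From mathcomp Require Import boolp.

Set Implicit Arguments.
Unset Strict Implicit.
Unset Printing Implicit Defensive.

Import Order.TTheory GRing.Theory Num.Theory.

(* Link diagrams in the 2-sphere.  Remove from the sphere a point off the
   diagram and put the diagram in generic position with respect to the height
   function of the resulting plane.  Cut along horizontal lines, it becomes a
   sequence of slices, listed from bottom to top, each containing exactly one
   minimum, maximum or crossing.  A slice [(i, s)] has [i] vertical strands to
   the left of the singular piece [s].  Minima carry a label in [A]: for
   [A = bool] it orients the diagram ([true] when the left of the two strands
   created by the minimum runs upwards), for [A = unit] the diagram is
   unoriented. *)
Inductive shape (A : Type) : Type :=
| Cup of A
| Cap
| Cross of bool. (* [true]: the strand from bottom left to top right is over *)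

Arguments Cap {A}.
Arguments Cross {A}.

Definition slice (A : Type) : Type := (nat * shape A)%type.

Definition word : Type := seq (slice unit).
Definition oriented_word : Type := seq (slice bool).

Definition forget (D : oriented_word) : word :=
  [seq (x.1, match x.2 with
             | Cup _ => Cup tt
             | Cap => Cap
             | Cross c => Cross c
             end) | x <- D].

(* Numbers of strands below and above the singular piece. *)
Definition arity_in (A : Type) (s : shape A) : nat := if s is Cup _ then 0 else 2.
Definition arity_out (A : Type) (s : shape A) : nat := if s is Cap then 0 else 2.

(* Number of strands above a word that has [n] strands below it; [None] if some
   slice does not fit. *)
Fixpoint width (w : word) (n : nat) : option nat :=
  if w is (i, s) :: w' then
    if i + arity_in s <= n then width w' (n - arity_in s + arity_out s)
    else None
  else Some n.

Definition link_diagram (w : word) : bool := width w 0 == Some 0.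

(* [s] with its [n] entries at positions [i], ..., [i + n - 1] replaced by [t]. *)
Definition splice (T : Type) (i n : nat) (t s : seq T) : seq T :=
  take i s ++ t ++ drop (i + n) s.

(* The entries of [s] label the strands at the current height; two strands have
   the same label when the part of the diagram below that height connects them.
   A component is counted at the maximum which closes it.  The labels
   [size w'], which decrease along the word, are fresh. *)
Fixpoint components_from (s : seq nat) (w : word) : nat :=
  if w is (i, p) :: w' then
    let a := nth 0 s i in
    let b := nth 0 s i.+1 in
    match p with
    | Cup _ => components_from (splice i 0 [:: size w'; size w'] s) w'
    | Cross _ => components_from (splice i 2 [:: b; a] s) w'
    | Cap => (a == b) +
        components_from [seq if x == b then a else x | x <- splice i 2 [::] s] w'
    end
  else 0.

Definition components (w : word) : nat := components_from [::] w.

(* Directions ([true]: upwards) of the strands above an oriented word, given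
   those of the strands below it; [None] if some slice does not fit or some
   maximum joins two strands with inconsistent orientations. *)
Fixpoint directions (D : oriented_word) (s : seq bool) : option (seq bool) :=
  if D is (i, p) :: D' then
    let a := nth false s i in
    let b := nth false s i.+1 in
    if i + arity_in p <= size s then
      match p with
      | Cup d => directions D' (splice i 0 [:: d; ~~ d] s)
      | Cross _ => directions D' (splice i 2 [:: b; a] s)
      | Cap => if a != b then directions D' (splice i 2 [::] s) else None
      end
    else None
  else Some s.

Definition oriented_link_diagram (D : oriented_word) : bool :=
  directions D [::] == Some [::].

Definition knot_diagram (D : oriented_word) : bool :=
  oriented_link_diagram D && (components (forget D) == 1).

(* [w2] is obtained from [w1] by replacing a block of consecutive slices
   according to [R], in either direction. *)
Definition locally (A : Type) (R : seq (slice A) -> seq (slice A) -> Prop)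
    (w1 w2 : seq (slice A)) : Prop :=
  exists u v l r, (R l r \/ R r l) /\ w1 = u ++ l ++ v /\ w2 = u ++ r ++ v.

(* Isotopies of the plane, which are part of every Reidemeister sequence:
   changing the relative height of two singular pieces side by side, creating or
   cancelling a minimum and a maximum, and turning a crossing around a maximum
   or a minimum.  Together with the moves of types I,
   II and III below they generate isotopy of links; in particular they generate
   the isotopies of the sphere sweeping a strand across the removed point. *)
Inductive isotopy_block : word -> word -> Prop :=
| Iso_exchange i k p q :
    isotopy_block [:: (i, p); (i + arity_out p + k, q)]
                  [:: (i + arity_in p + k, q); (i, p)]
| Iso_zigzag_left i :
    isotopy_block [:: (i.+1, Cup tt); (i, Cap)] [::]
| Iso_zigzag_right i :
    isotopy_block [:: (i, Cup tt); (i.+1, Cap)] [::]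
| Iso_turn_cap i c :
    isotopy_block [:: (i, Cross c); (i.+1, Cap)] [:: (i.+1, Cross (~~ c)); (i, Cap)]
| Iso_turn_cup i c :
    isotopy_block [:: (i.+1, Cup tt); (i, Cross c)] [:: (i, Cup tt); (i.+1, Cross (~~ c))].

Inductive R1_block : word -> word -> Prop :=
| R1_cap i c : R1_block [:: (i, Cross c); (i, Cap)] [:: (i, Cap)]
| R1_cup i c : R1_block [:: (i, Cup tt); (i, Cross c)] [:: (i, Cup tt)].

Inductive R2_block : word -> word -> Prop :=
| R2_cross i c : R2_block [:: (i, Cross c); (i, Cross (~~ c))] [::].

(* Isotopy puts any triangle bounded by three crossings in this position, with
   three monotone strands.  The condition on [a], [b], [c] says that one of the three strands is above
   the other two and one is below the other two; without it each strand would
   be over exactly one of the others. *)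
Inductive R3_block (A : Type) : seq (slice A) -> seq (slice A) -> Prop :=
| R3_cross i a b c : (a == b) || (b == c) ->
    R3_block [:: (i, Cross a); (i.+1, Cross b); (i, Cross c)]
             [:: (i.+1, Cross c); (i, Cross b); (i.+1, Cross a)].

Inductive change_block : word -> word -> Prop :=
| Change_cross i c : change_block [:: (i, Cross c)] [:: (i, Cross (~~ c))].

Definition reidemeister (w1 w2 : word) : Prop :=
  [/\ link_diagram w1, link_diagram w2 &
      [\/ locally isotopy_block w1 w2, locally R1_block w1 w2,
          locally R2_block w1 w2 | locally (@R3_block unit) w1 w2]].

Definition RIII_move (D E : oriented_word) : Prop := locally (@R3_block bool) D E.

(* [deforms n w w']: a sequence of Reidemeister moves and exactly [n] crossing
   changes leads from [w] to [w']. *)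
Inductive deforms : nat -> word -> word -> Prop :=
| Deforms_refl w : link_diagram w -> deforms 0 w w
| Deforms_reidemeister n w1 w2 w3 :
    reidemeister w1 w2 -> deforms n w2 w3 -> deforms n w1 w3
| Deforms_change n w1 w2 w3 :
    link_diagram w1 -> locally change_block w1 w2 -> deforms n w2 w3 ->
    deforms n.+1 w1 w3.

Definition disjoint_circles (m : nat) : word :=
  flatten (nseq m [:: (0, Cup tt); (0, Cap)]).

(* A diagram of the trivial [m]-component link is one which Reidemeister moves
   take to [m] disjoint circles. *)
Definition trivial_link_diagram (m : nat) (w : word) : Prop :=
  deforms 0 w (disjoint_circles m).

Definition unlinked_by (w : word) (n : nat) : Prop :=
  exists w', deforms n w w' /\ trivial_link_diagram (components w) w'.

(* Minimum of [unlinked_by w].  The value 0 in the second case is irrelevant: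
   crossing changes make every link diagram descending, hence trivial. *)
Definition unknotting_number (w : word) : nat :=
  match pselect (exists n, `[< unlinked_by w n >]) with
  | left h => ex_minn h
  | right _ => 0
  end.

Definition is_crossing (D : oriented_word) (k : nat) : bool :=
  if (nth (0, Cap) D k).2 is Cross _ then true else false.

(* Whether the two strands at the crossing in slice [k] run both upwards or both
   downwards. *)
Definition parallel (D : oriented_word) (k : nat) : bool :=
  if directions (take k D) [::] is Some s then
    let i := (nth (0, Cap) D k).1 in nth false s i == nth false s i.+1
  else false.

Definition crossing_sign (D : oriented_word) (k : nat) : int :=
  if (nth (0, Cap) D k).2 is Cross c then
    (if c == parallel D k then 1 else -1)%R
  else 0%R.

(* The two ways of pasting the four ends at slice [k]: into two vertical strands,
   or into a maximum with a minimum above it. *)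
Definition smooth_vertical (D : oriented_word) (k : nat) : word :=
  forget (take k D ++ drop k.+1 D).

Definition smooth_horizontal (D : oriented_word) (k : nat) : word :=
  let i := (nth (0, Cap) D k).1 in
  forget (take k D) ++ [:: (i, Cap); (i, Cup tt)] ++ forget (drop k.+1 D).

Definition regular_smoothing (D : oriented_word) (k : nat) : word :=
  if parallel D k then smooth_vertical D k else smooth_horizontal D k.

Definition irregular_smoothing (D : oriented_word) (k : nat) : word :=
  if parallel D k then smooth_horizontal D k else smooth_vertical D k.

Local Open Scope ring_scope.

Definition iu_with (smoothing : oriented_word -> nat -> word) (D : oriented_word) : int :=
  \sum_(k < size D | is_crossing D k)
    crossing_sign D k *
    `|(unknotting_number (smoothing D k))%:Z - (unknotting_number (forget D))%:Z|.

Definition iu_plus (D : oriented_word) : int := iu_with regular_smoothing D.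

Definition iu_minus (D : oriented_word) : int := iu_with irregular_smoothing D.

(* Main.v *)
Require Import Defs.
From mathcomp Require Import all_boot all_order all_algebra.
From mathcomp Require Import boolp ring zify.

(** The diagrams are closures of the positive 3-braids [s0 s1 s0 s1] and
    [s1 s0 s1 s1]; the move is the braid relation [s0 s1 s0 = s1 s0 s1].  Both
    are diagrams of a trefoil, which has unknotting number 1, and all their
    crossings are positive.

    A move of type III moves the middle strand across the crossing of the top
    and the bottom strands, and only the smoothings at that crossing can change
    their link type.  Here this is the second crossing.  Its regular smoothing
    turns from a Hopf link into a split union of a trefoil and a circle.  The
    linking number changes by 1, as it must, but both links have unknotting
    number 1.  Its irregular smoothing turns from an unknot into a trefoil.  All
    the other regular smoothings are Hopf links and all the other irregular ones
    are unknots.  Every summand of [iu_plus] is thus [|1 - 1|], before and after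
    the move, whereas [iu_minus] adds up [|0 - 1|] four times before the move
    and three times after it.

    All these unknotting numbers are 0 or 1, so that two tools suffice.  Upper
    bounds come from explicit moves: the relation [~>] between tangles, which
    can be used inside any diagram, lets one rewrite a diagram piece by piece.
    The lower bound 1 comes from the number of Fox 3-colourings, which
    Reidemeister moves preserve ([reidemeister_colourings]) and which is [3 ^ m]
    for the trivial link with [m] components.  It is 9 for the trefoil knot, 3
    for the Hopf link and 27 for the trefoil together with a circle. *)

Set Implicit Arguments.
Unset Strict Implicit.
Unset Printing Implicit Defensive.

Import GRing.Theory.

(** * Fox 3-colourings *)

Notation colour := 'Z_3.

(** The colour different from [a] and [b] if these differ, and [a] if they are
    equal.  For the three arcs at a crossing the relation [third a b = c] is
    symmetric in the three colours, whence the symmetric formula instead of the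
    usual [2 * a - b]. *)
Definition third (a b : colour) : colour := (- (a + b))%R.

Lemma thirdC a b : third a b = third b a.
Proof. by rewrite /third addrC. Qed.

Lemma thirdK a : involutive (third a).
Proof. by move=> b; rewrite /third; ring. Qed.

Lemma third_idem a : third a a = a.
Proof. by case: a => [[|[|[|]]]] // ?; apply/val_inj. Qed.

(** Reidemeister's third move: to carry an arc of colour [a] over a crossing is
    to apply the automorphism [third a] to the colours there. *)
Lemma third_distr a b c : third a (third b c) = third (third a b) (third a c).
Proof.
(* The identity holds only modulo 3; writing [a] as [third a a], which is
   [- 2 * a], turns it into one that holds in every commutative ring. *)
by rewrite -[in LHS](third_idem a) /third; ring.
Qed.

Lemma third_eq a b : (third a b == b) = (a == b).
Proof.
apply/eqP/eqP=> [h|->]; last exact: third_idem.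
by rewrite -[a](thirdK b) (thirdC b a) h third_idem.
Qed.

Variant colour_spec (a : colour) : Prop :=
| Colour0 of a = 0%R
| Colour1 of a = 1%R
| ColourN1 of a = (-1)%R.

Lemma colourP a : colour_spec a.
Proof.
case: a => [[|[|[|//]]] lt_a3].
- by apply: Colour0; apply: val_inj.
- by apply: Colour1; apply: val_inj.
- by apply: ColourN1; apply: val_inj.
Qed.

Lemma third_table :
  ((third 0 0 = 0)%R * (third 0 1 = -1)%R * (third 0 (-1) = 1)%R *
   (third 1 0 = -1)%R * (third 1 1 = 1)%R * (third 1 (-1) = 0)%R *
   (third (-1) 0 = 1)%R * (third (-1) 1 = 0)%R * (third (-1) (-1) = -1)%R)%type.
Proof. by do !split; apply: val_inj. Qed.

(** A colouring is built from bottom to top: a minimum leaves the choice of a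
    colour, a crossing none, and a maximum may turn out to be impossible. *)
Definition local_colourings (p : Defs.shape unit) (s : seq colour) :
    seq (seq colour) :=
  match p, s with
  | Cup _, _ => [seq [:: a; a] | a <- [:: 0%R; 1%R; (-1)%R]]
  | Cap, [:: a; b] => if a == b then [:: [::]] else [::]
  | Cross c, [:: a; b] =>
      [:: if c then [:: third a b; a] else [:: b; third a b]]
  | _, _ => [::]
  end.

(** The continuation [f] stands for the part of the diagram above [w]; for
    [f = fun=> 1] this is the number of ways to extend to [w] a colouring of the
    strands below it. *)
Fixpoint extend (f : seq colour -> nat) (w : word) (s : seq colour) : nat :=
  if w is (i, p) :: w' then
    sumn [seq extend f w' (splice i (arity_in p) t s)
         | t <- local_colourings p (take (arity_in p) (drop i s))]
  else f s.

Definition colourings (w : word) : nat := extend (fun=> 1) w [::].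

Lemma extend_cat f u v s : extend f (u ++ v) s = extend (extend f v) u s.
Proof.
elim: u s => //= -[i p] u IHu s.
by congr sumn; apply: eq_map => t; rewrite IHu.
Qed.

Definition shift (j : nat) (w : word) : word := [seq (j + x.1, x.2) | x <- w].

(** Strands to the left of a tangle do not interact with it, so that the
    invariance of [extend] under a move need only be checked at position 0. *)
Lemma extend_shift f q w s :
  extend f (shift (size q) w) (q ++ s) = extend (fun t => f (q ++ t)) w s.
Proof.
elim: w s => //= -[i p] w IHw s /=.
have dropq n : drop (size q + n) (q ++ s) = drop n s.
  by rewrite addnC -drop_drop drop_size_cat.
rewrite dropq; congr sumn; apply: eq_map => t; rewrite -IHw.
by rewrite /splice -addnA dropq take_cat ltnNge leq_addr /= addKn -catA.
Qed.

Lemma extend_slice f a x b p w : size x = arity_in p ->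
  extend f ((size a, p) :: w) (a ++ x ++ b) =
  \sum_(t <- local_colourings p x) extend f w (a ++ t ++ b).
Proof.
move=> hx; rewrite /= sumnE big_map drop_size_cat // take_size_cat //.
have dropax : drop (size a + arity_in p) (a ++ x ++ b) = b.
  by rewrite -hx -size_cat catA drop_size_cat.
by apply: eq_bigr => t _; rewrite /splice take_size_cat // dropax.
Qed.

Lemma size_local p s t :
  size s = arity_in p -> t \in local_colourings p s -> size t = arity_out p.
Proof.
case: p => [a||c]; case: s => [|x [|y [|z s]]] //= _.
- by rewrite !inE => /or3P[]/eqP->.
- by case: eqP => // _; rewrite inE => /eqP->.
- by rewrite inE => /eqP->; case: c.
Qed.

Lemma size_splice (T : Type) i n (t s : seq T) :
  i + n <= size s -> size (splice i n t s) = size s - n + size t.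
Proof.
by move=> h; rewrite /splice !size_cat size_take size_drop; case: ltnP; lia.
Qed.

Lemma split_at (s : seq colour) i : i <= size s ->
  exists q t, s = q ++ t /\ size q = i.
Proof.
by move=> h; exists (take i s), (drop i s); rewrite cat_take_drop size_takel.
Qed.

Lemma width_cat u v n : width (u ++ v) n = obind (width v) (width u n).
Proof. by elim: u n => //= -[i p] u IHu n; case: ifP => // _; apply: IHu. Qed.

Lemma eq_extend f g w s : width w (size s) ->
  (forall t, width w (size s) = Some (size t) -> f t = g t) ->
  extend f w s = extend g w s.
Proof.
elim: w s => [|[i p] w IHw] s /=; first by move=> _; apply.
case: ifP => // fits hw hfg; congr sumn; apply/eq_in_map => t.
have size_in : size (take (arity_in p) (drop i s)) = arity_in p.
  by rewrite size_takel // size_drop; lia.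
move/(size_local size_in) => size_t.
have size_s : size (splice i (arity_in p) t s) = size s - arity_in p + arity_out p.
  by rewrite size_splice // size_t.
by apply: IHw => [|t']; rewrite size_s //; apply: hfg.
Qed.

(** The sides of a move are only compared on numbers of strands that fit them:
    on too few strands a zigzag, say, makes no sense, while the empty tangle it
    is replaced by does. *)
Definition same_colourings (l r : word) : Prop :=
  forall f s, width l (size s) != None -> width r (size s) != None ->
  extend f l s = extend f r s.

Lemma same_sym l r : same_colourings l r -> same_colourings r l.
Proof. by move=> h f s hr hl; rewrite h. Qed.

Lemma same_at i k l r :
  (forall f s, k <= size s -> extend f l s = extend f r s) ->
  (forall n, width (shift i l) n != None -> width (shift i r) n != None ->
     i + k <= n) ->
  same_colourings (shift i l) (shift i r).
Proof.
move=> same_lr fits f s hl hr; have := fits _ hl hr => hs.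
have size_q : size (take i s) = i by rewrite size_takel //; lia.
rewrite -[s](cat_take_drop i) -{1 4}size_q !extend_shift same_lr //.
by rewrite size_drop; lia.
Qed.

Local Ltac colour_strands := do 4 rewrite /= /splice /= ?drop0 ?take0 ?addn0.

Lemma isotopy_same l r : isotopy_block l r -> same_colourings l r.
Proof.
case=> [i k p q|i|i|i c|i c].
(* Pieces side by side are coloured independently, in either order. *)
- suff: same_colourings (shift i [:: (0, p); (arity_out p + k, q)])
   (shift i [:: (arity_in p + k, q); (0, p)]).
    by rewrite /shift /= addn0 !addnA.
  apply: (@same_at _ (arity_in p + k + arity_in q)) => [f s hs | n]; last first.
    rewrite [width (shift _ [:: (arity_in p + k, _); _]) _]/=; case: ifP => //; lia.
  have [a [s1 [es sa]]] : exists a s1, s = a ++ s1 /\ size a = arity_in p.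
    by apply: split_at; lia.
  move: hs; rewrite es size_cat => hs.
  have [b [s2 [es1 sb]]] : exists b s2, s1 = b ++ s2 /\ size b = k.
    by apply: split_at; lia.
  move: hs; rewrite es1 size_cat => hs.
  have [c [d [es2 sc]]] : exists c d, s2 = c ++ d /\ size c = arity_in q.
    by apply: split_at; lia.
  rewrite {}es2 (@extend_slice f [::] a) // -[RHS]/(extend f _ _).
  transitivity (\sum_(t <- local_colourings p a) \sum_(u <- local_colourings q c)
                  f (t ++ b ++ u ++ d)).
    rewrite big_seq [RHS]big_seq; apply: eq_bigr => t /(size_local sa) st.
    rewrite cat0s catA -st -sb -size_cat extend_slice //.
    by apply: eq_bigr => u _; rewrite -catA.
  rewrite catA -sa -sb -size_cat extend_slice // exchange_big.
  apply: eq_bigr => u _.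
  by rewrite -catA (@extend_slice f [::] a).
(* Exactly one colour at the minimum fits the strand at the maximum. *)
- suff: same_colourings (shift i [:: (1, Cup tt); (0, Cap)]) (shift i [::]).
    by rewrite /shift /= addn0 addn1.
  apply: (@same_at _ 1) => [f [|x s] //= _ | n /=]; last by case: ifP => //; lia.
  by colour_strands; case: (colourP x) => ->; rewrite /= ?addn0.
- suff: same_colourings (shift i [:: (0, Cup tt); (1, Cap)]) (shift i [::]).
    by rewrite /shift /= addn0 addn1.
  apply: (@same_at _ 1) => [f [|x s] //= _ | n /=]; last by do 2?case: ifP => // ?; lia.
  by colour_strands; case: (colourP x) => ->; rewrite /= ?addn0.
- suff: same_colourings (shift i [:: (0, Cross c); (1, Cap)])
      (shift i [:: (1, Cross (~~ c)); (0, Cap)]).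
    by rewrite /shift /= addn0 addn1.
  apply: (@same_at _ 3) => [f [|x [|y [|z s]]] //= _ | n /=]; last first.
    by do 6?case: ifP => // ?; lia.
  case: c; colour_strands.
    by case: eqP => // ->; rewrite /= (thirdC y).
  by rewrite (thirdC x) (can2_eq (thirdK y) (thirdK y)); case: eqP.
- suff: same_colourings (shift i [:: (1, Cup tt); (0, Cross c)])
      (shift i [:: (0, Cup tt); (1, Cross (~~ c))]).
    by rewrite /shift /= addn0 addn1.
  apply: (@same_at _ 1) => [f [|x s] //= _ | n /=]; last first.
    by do 6?case: ifP => // ?; lia.
  case: c; colour_strands; last by rewrite !(thirdC x).
  (* The colours [a] and [third x a] of the ends of the minimum change places:
     both sums run over the same terms. *)
  by case: (colourP x) => ->; rewrite !third_table; ring.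
Qed.

Lemma R1_same l r : R1_block l r -> same_colourings l r.
Proof.
case=> i c.
- suff: same_colourings (shift i [:: (0, Cross c); (0, Cap)])
      (shift i [:: (0, Cap)]).
    by rewrite /shift /= addn0.
  apply: (@same_at _ 2) => [f [|x [|y s]] //= _ | n /=]; last by case: ifP => //; lia.
  case: c; colour_strands.
    by rewrite thirdC third_eq eq_sym; case: eqP => //= _; colour_strands.
  by rewrite eq_sym third_eq; case: eqP => //= _; colour_strands.
- suff: same_colourings (shift i [:: (0, Cup tt); (0, Cross c)])
      (shift i [:: (0, Cup tt)]).
    by rewrite /shift /= addn0.
  apply: (@same_at _ 0) => [f s _ | n /=]; last by case: ifP => //; lia.
  by case: c; colour_strands; rewrite !third_idem.
Qed.

Lemma R2_same l r : R2_block l r -> same_colourings l r.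
Proof.
case=> i c.
suff: same_colourings (shift i [:: (0, Cross c); (0, Cross (~~ c))]) (shift i [::]).
  by rewrite /shift /= addn0.
apply: (@same_at _ 2) => [f [|x [|y s]] //= _ | n /=]; last by case: ifP => //; lia.
case: c; colour_strands; first by rewrite (thirdC _ x) thirdK.
by rewrite (thirdC x) thirdK.
Qed.

Lemma R3_same l r : R3_block l r -> same_colourings l r.
Proof.
case=> i a b c abc.
suff: same_colourings (shift i [:: (0, Cross a); (1, Cross b); (0, Cross c)])
   (shift i [:: (1, Cross c); (0, Cross b); (1, Cross a)]).
  by rewrite /shift /= addn0 addn1.
apply: (@same_at _ 3) => [f [|x [|y [|z s]]] //= _ | n /=]; last first.
  by do 6?case: ifP => // ?; lia.
move: abc; case: a; case: b; case: c => //= _; colour_strands.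
all: congr (f [:: _, _, _ & _]); rewrite -?third_distr //.
- by rewrite -!(thirdC z) third_distr.
- by rewrite third_distr (thirdC x y) thirdK.
- by rewrite [RHS]thirdC third_distr thirdK (thirdC y).
- by rewrite -!(thirdC z) third_distr.
Qed.

(** A move leaves the parts of the diagram below and above its block alone.  Both
    diagrams being well formed, the block meets only as many strands as it fits. *)
Lemma locally_colourings (R : word -> word -> Prop) w1 w2 :
  (forall l r, R l r -> same_colourings l r) -> locally R w1 w2 ->
  link_diagram w1 -> link_diagram w2 -> colourings w1 = colourings w2.
Proof.
move=> sameR [u [v [l [r [hR [-> ->]]]]]] /eqP hl /eqP hr.
have same_lr : same_colourings l r.
  by case: hR => [/sameR | /sameR /same_sym].
rewrite /colourings !extend_cat; apply: eq_extend => [|t /= ut].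
  by move: hl; rewrite width_cat; case: (width u 0).
move: hl hr; rewrite !width_cat ut /= !width_cat => hl hr.
rewrite !extend_cat same_lr //; first by move: hl; case: (width l _).
by move: hr; case: (width r _).
Qed.

Lemma reidemeister_colourings w1 w2 :
  reidemeister w1 w2 -> colourings w1 = colourings w2.
Proof.
case=> h1 h2 [] h12; apply: (locally_colourings _ h12) => //.
- exact: isotopy_same.
- exact: R1_same.
- exact: R2_same.
- exact: R3_same.
Qed.

Lemma deforms0_colourings w1 w2 : deforms 0 w1 w2 -> colourings w1 = colourings w2.
Proof.
move En: 0 => n h; elim: h En => // {}n w w' w'' /reidemeister_colourings -> _ IH.
exact: IH.
Qed.

Lemma colourings_disjoint_circles m : colourings (disjoint_circles m) = 3 ^ m.
Proof.
rewrite /colourings; elim: m => // m IHm.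
rewrite /disjoint_circles /= -/(disjoint_circles m); colour_strands.
by rewrite expnS -IHm; lia.
Qed.

Lemma unlinked_by0_colourings w :
  unlinked_by w 0 -> colourings w = 3 ^ components w.
Proof.
case=> w' [/deforms0_colourings -> /deforms0_colourings ->].
exact: colourings_disjoint_circles.
Qed.

(** * Unknotting numbers 0 and 1 *)

Lemma unknotting_number0 w : unlinked_by w 0 -> unknotting_number w = 0.
Proof.
move=> h0; rewrite /unknotting_number; case: pselect => // h.
by case: ex_minnP => n _ /(_ 0 (asboolT h0)); case: n.
Qed.

(** The number of colourings tells [w] from the trivial link with as many
    components, and excludes unlinking without a crossing change. *)
Lemma unknotting_number1 w :
  unlinked_by w 1 -> colourings w != 3 ^ components w -> unknotting_number w = 1.
Proof.
move=> h1 /eqP col; rewrite /unknotting_number; case: pselect => [h|[]]; last first.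
  by exists 1; apply/asboolP.
case: ex_minnP => -[|n] /asboolP hn /(_ 1 (asboolT h1)) le_n1.
  by have := unlinked_by0_colourings hn.
by case: n hn le_n1.
Qed.

(** * Rewriting tangles by isotopy *)

Lemma deforms_trans m n w1 w2 w3 :
  deforms m w1 w2 -> deforms n w2 w3 -> deforms (m + n) w1 w3.
Proof.
move=> h; elim: h w3 n => // {m w1 w2}.
- move=> m w1 w2 w2' h12 _ IH w3 n /IH; exact: Deforms_reidemeister.
- move=> m w1 w2 w2' d1 h12 _ IH w3 n /IH; exact: Deforms_change.
Qed.

Lemma deforms_diagram n w1 w2 : deforms n w1 w2 -> link_diagram w2.
Proof. by elim. Qed.

(** Being replaceable inside every diagram is what makes derived moves, such as
    [destabilise] below, usable in the same way as the basic ones. *)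
Variant replaceable (l r : word) : Prop := Replaceable of forall u v,
  link_diagram (u ++ l ++ v) -> deforms 0 (u ++ l ++ v) (u ++ r ++ v).

Notation "l ~> r" := (replaceable l r) (at level 70).

Lemma replace_refl w : w ~> w.
Proof. by split=> u v; apply: Deforms_refl. Qed.

Lemma replace_trans w1 w2 w3 : w1 ~> w2 -> w2 ~> w3 -> w1 ~> w3.
Proof.
case=> h12 [h23]; split=> u v /h12 d12; rewrite -[0]addn0.
exact: deforms_trans d12 (h23 _ _ (deforms_diagram d12)).
Qed.

(** For explicit words the equation is checked by computation, which makes a
    deformation a list of slice numbers [k] and moves. *)
Lemma replace_at k l r w w' : l ~> r -> take (size l) (drop k w) = l ->
  take k w ++ r ++ drop (size l) (drop k w) ~> w' -> w ~> w'.
Proof.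
case=> lr hl; apply: replace_trans; split=> u v.
rewrite -{1 2}[w](cat_take_drop k) -{1 2}[drop k w](cat_take_drop (size l)) hl.
by rewrite -!catA !(catA u); apply: lr.
Qed.

Definition move_block (l r : word) : Prop :=
  [\/ isotopy_block l r, R1_block l r, R2_block l r | R3_block l r].

(** The context [a], [b] supplies the strands without which a move that creates
    crossings out of nothing would not fit. *)
Lemma replace_block a b l r : move_block l r \/ move_block r l ->
  (forall n, width (a ++ l ++ b) n -> width (a ++ r ++ b) n = width (a ++ l ++ b) n) ->
  a ++ l ++ b ~> a ++ r ++ b.
Proof.
move=> lr same_width; split=> u v hl.
have hr : link_diagram (u ++ (a ++ r ++ b) ++ v).
  move: hl; rewrite /link_diagram !(width_cat u).
  case: (width u 0) => //= n; rewrite !(width_cat _ v) => hl; rewrite same_width //.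
  by move: hl; case: (width _ n).
apply: Deforms_reidemeister (Deforms_refl hr); split=> //.
rewrite -!catA !(catA u).
have loc R : R l r \/ R r l ->
    locally R ((u ++ a) ++ l ++ b ++ v) ((u ++ a) ++ r ++ b ++ v).
  by exists (u ++ a), (b ++ v), l, r.
by case: lr => [[h|h|h|h]|[h|h|h|h]];
  [constructor 1|constructor 2|constructor 3|constructor 4
  |constructor 1|constructor 2|constructor 3|constructor 4];
  apply: loc; auto.
Qed.

Local Ltac compare_widths :=
  do ![case: ifP => //]; move=> *; try congr Some; lia.

Lemma block_width l r n : move_block l r -> width l n -> width r n = width l n.
Proof.
move: n => /[swap].
by case; [case=> [i k p q|i|i|i c|i c] | case=> i c | case=> i c
          | case=> i a b c _] => n /=; compare_widths.
Qed.

Lemma replace_by_move l r : move_block l r -> l ~> r.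
Proof.
move=> lr; rewrite -[l]cats0 -[r]cats0.
apply: (replace_block (a := [::])); first by left.
by move=> n; rewrite !cats0 /=; apply: block_width.
Qed.

(** Undoing a zigzag or a move of type II is excluded by the condition on the
    widths, since it makes sense next to enough strands only. *)
Lemma replace_by_reverse_move l r : move_block r l ->
  (forall n, width l n -> width r n = width l n) -> l ~> r.
Proof.
move=> rl h; rewrite -[l]cats0 -[r]cats0.
apply: (replace_block (a := [::])); first by right.
by move=> n; rewrite !cats0 /=; apply: h.
Qed.

Lemma swap i k p q :
  [:: (i, p); (i + arity_out p + k, q)] ~> [:: (i + arity_in p + k, q); (i, p)].
Proof. by apply: replace_by_move; constructor 1; constructor. Qed.

Lemma swap_rev i k p q :
  [:: (i + arity_in p + k, q); (i, p)] ~> [:: (i, p); (i + arity_out p + k, q)].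
Proof.
apply: replace_by_reverse_move => [|n /=]; first by constructor 1; constructor.
by compare_widths.
Qed.

Lemma zigzag_left i : [:: (i.+1, Cup tt); (i, Cap)] ~> [::].
Proof. by apply: replace_by_move; constructor 1; constructor. Qed.

Lemma zigzag_right i : [:: (i, Cup tt); (i.+1, Cap)] ~> [::].
Proof. by apply: replace_by_move; constructor 1; constructor. Qed.

Lemma turn_cap i c :
  [:: (i, Cross c); (i.+1, Cap)] ~> [:: (i.+1, Cross (~~ c)); (i, Cap)].
Proof. by apply: replace_by_move; constructor 1; constructor. Qed.

Lemma turn_cap_rev i c :
  [:: (i.+1, Cross c); (i, Cap)] ~> [:: (i, Cross (~~ c)); (i.+1, Cap)].
Proof.
apply: replace_by_reverse_move => [|n /=].
  by rewrite -{2}[c]negbK; constructor 1; constructor.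
by compare_widths.
Qed.

Lemma turn_cup i c :
  [:: (i.+1, Cup tt); (i, Cross c)] ~> [:: (i, Cup tt); (i.+1, Cross (~~ c))].
Proof. by apply: replace_by_move; constructor 1; constructor. Qed.

Lemma turn_cup_rev i c :
  [:: (i, Cup tt); (i.+1, Cross c)] ~> [:: (i.+1, Cup tt); (i, Cross (~~ c))].
Proof.
apply: replace_by_reverse_move => [|n /=].
  by rewrite -{2}[c]negbK; constructor 1; constructor.
by compare_widths.
Qed.

Lemma untwist_cap i c : [:: (i, Cross c); (i, Cap)] ~> [:: (i, Cap)].
Proof. by apply: replace_by_move; constructor 2; constructor. Qed.

Lemma untwist_cup i c : [:: (i, Cup tt); (i, Cross c)] ~> [:: (i, Cup tt)].
Proof. by apply: replace_by_move; constructor 2; constructor. Qed.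

Lemma separate i c : [:: (i, Cross c); (i, Cross (~~ c))] ~> [::].
Proof. by apply: replace_by_move; constructor 3; constructor. Qed.

Lemma slide i a b c : (a == b) || (b == c) ->
  [:: (i, Cross a); (i.+1, Cross b); (i, Cross c)] ~>
  [:: (i.+1, Cross c); (i, Cross b); (i.+1, Cross a)].
Proof. by move=> abc; apply: replace_by_move; constructor 4; constructor. Qed.

Lemma slide_rev i a b c : (a == b) || (b == c) ->
  [:: (i.+1, Cross c); (i, Cross b); (i.+1, Cross a)] ~>
  [:: (i, Cross a); (i.+1, Cross b); (i, Cross c)].
Proof.
move=> abc; apply: replace_by_reverse_move => [|n /=].
  by constructor 4; constructor.
by compare_widths.
Qed.

(** Markov's move: if the last strand of a closed braid takes part in a single
    crossing, that crossing is a curl. *)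
Lemma destabilise i c :
  [:: (i.+1, Cup tt); (i, Cross c); (i.+1, Cap)] ~> [::].
Proof.
apply: (replace_at (k := 0) (turn_cup i c)) => //=.
apply: (replace_at (k := 1) (untwist_cap i.+1 (~~ c))) => //=.
exact: zigzag_right.
Qed.

(** The circle slides under the strand to its left, with a move of type II before
    and after.  In the plane, this is how a circle leaves another one. *)
Lemma pull_out_circle i :
  [:: (i.+1, Cup tt); (i.+1, Cap)] ~> [:: (i, Cup tt); (i, Cap)].
Proof.
apply: (@replace_trans _
  [:: (i.+1, Cup tt); (i, Cross true); (i, Cross false); (i.+1, Cap)]).
  apply: (@replace_block [:: (i.+1, Cup tt)] [:: (i.+1, Cap)] [::]
    [:: (i, Cross true); (i, Cross false)]) => [|n /=].
    by right; constructor 3; exact: (R2_cross i true).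
  by compare_widths.
apply: (replace_at (k := 0) (turn_cup i true)) => //=.
apply: (replace_at (k := 2) (turn_cap i false)) => //=.
by apply: (replace_at (k := 1) (separate i.+1 false)) => //=; exact: replace_refl.
Qed.

Lemma unlinked_by0 w :
  link_diagram w -> w ~> disjoint_circles (components w) -> unlinked_by w 0.
Proof.
move=> dw [h]; exists w; split; first exact: Deforms_refl.
by have := h [::] [::]; rewrite /= !cats0; apply.
Qed.

Lemma unlinked_by1 k i c w : link_diagram w ->
  take 1 (drop k w) = [:: (i, Cross c)] ->
  take k w ++ (i, Cross (~~ c)) :: drop k.+1 w ~> disjoint_circles (components w) ->
  unlinked_by w 1.
Proof.
move=> dw wk [h].
have ew : w = take k w ++ [:: (i, Cross c)] ++ drop k.+1 w.
  rewrite -[in LHS](cat_take_drop k w) -[drop k w in LHS](cat_take_drop 1).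
  by rewrite wk drop_drop.
have dw' : link_diagram (take k w ++ (i, Cross (~~ c)) :: drop k.+1 w).
  by move: dw; rewrite {1}ew /link_diagram !width_cat.
exists (take k w ++ (i, Cross (~~ c)) :: drop k.+1 w); split.
  apply: (Deforms_change dw _ (Deforms_refl dw')).
  exists (take k w), (drop k.+1 w), [:: (i, Cross c)], [:: (i, Cross (~~ c))].
  by split; first by left.
by have := h [::] [::]; rewrite /= !cats0; apply.
Qed.

(** * Closures of tangles with three strands *)

Definition closure3 (A : Type) (a : A) (t : seq (slice A)) : seq (slice A) :=
  [:: (0, Cup a); (1, Cup a); (2, Cup a)] ++ t ++ [:: (2, Cap); (1, Cap); (0, Cap)].

Notation sigma i := (i, Cross true).
Notation sigma' i := (i, Cross false).
Notation cap i := (i, Cap).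
Notation cup i := (i, Cup tt).
Notation cl := (closure3 tt).

Lemma adjacent_circles :
  [:: (0, Cup tt); (0, Cup tt); (0, Cap); (0, Cap)] ~> disjoint_circles 2.
Proof.
apply: (replace_at (k := 0) (swap_rev 0 0 (Cup tt) (Cup tt))) => //=.
apply: (replace_at (k := 1) (swap_rev 0 0 Cap (Cup tt))) => //=.
exact: replace_refl.
Qed.

Lemma nested_circles :
  [:: (0, Cup tt); (1, Cup tt); (1, Cap); (0, Cap)] ~> disjoint_circles 2.
Proof.
by apply: (replace_at (k := 1) (pull_out_circle 0)) => //=; exact: adjacent_circles.
Qed.

(** * Trefoils and Hopf links *)

(** After the braid relation the last two crossings are both [s1], and cancel
    once one of them is changed; two destabilisations undo the rest. *)
Lemma trefoil_s0_s1_s0_s1 :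
  unknotting_number (cl [:: sigma 0; sigma 1; sigma 0; sigma 1]) = 1.
Proof.
apply: unknotting_number1; last by vm_compute.
apply: (@unlinked_by1 6 1 true) => //=.
apply: (replace_at (k := 3) (@slide 0 true true true isT)) => //=.
apply: (replace_at (k := 5) (separate 1 true)) => //=.
apply: (replace_at (k := 4) (swap 0 0 (Cross true) Cap)) => //=.
apply: (replace_at (k := 2) (destabilise 1 true)) => //=.
apply: (replace_at (k := 1) (destabilise 0 true)) => //=.
exact: replace_refl.
Qed.

Lemma trefoil_s1_s0_s1_s1 :
  unknotting_number (cl [:: sigma 1; sigma 0; sigma 1; sigma 1]) = 1.
Proof.
apply: unknotting_number1; last by vm_compute.
apply: (@unlinked_by1 6 1 true) => //=.
apply: (replace_at (k := 5) (separate 1 true)) => //=.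
apply: (replace_at (k := 4) (swap 0 0 (Cross true) Cap)) => //=.
apply: (replace_at (k := 2) (destabilise 1 true)) => //=.
apply: (replace_at (k := 1) (destabilise 0 true)) => //=.
exact: replace_refl.
Qed.

(** Changing the last crossing gives [s1 s0 s1^-1], which the braid relation
    turns into [s0^-1 s1 s0].  There [s1] occurs only once, and the third strand
    can be removed. *)
Lemma hopf_s1_s0_s1 : unknotting_number (cl [:: sigma 1; sigma 0; sigma 1]) = 1.
Proof.
apply: unknotting_number1; last by vm_compute.
apply: (@unlinked_by1 5 1 true) => //=.
apply: (replace_at (k := 3) (@slide_rev 0 false true true isT)) => //=.
apply: (replace_at (k := 2) (swap_rev 0 0 (Cross false) (Cup tt))) => //=.
apply: (replace_at (k := 5) (swap 0 0 (Cross true) Cap)) => //=.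
apply: (replace_at (k := 3) (destabilise 1 true)) => //=.
apply: (replace_at (k := 2) (separate 0 false)) => //=.
exact: nested_circles.
Qed.

Lemma hopf_s0_s1_s0 : unknotting_number (cl [:: sigma 0; sigma 1; sigma 0]) = 1.
Proof.
apply: unknotting_number1; last by vm_compute.
apply: (@unlinked_by1 5 0 true) => //=.
apply: (replace_at (k := 2) (swap_rev 0 0 (Cross true) (Cup tt))) => //=.
apply: (replace_at (k := 5) (swap 0 0 (Cross false) Cap)) => //=.
apply: (replace_at (k := 3) (destabilise 1 true)) => //=.
apply: (replace_at (k := 2) (separate 0 true)) => //=.
exact: nested_circles.
Qed.

Lemma hopf_s0_s0_s1 : unknotting_number (cl [:: sigma 0; sigma 0; sigma 1]) = 1.
Proof.
apply: unknotting_number1; last by vm_compute.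
apply: (@unlinked_by1 3 0 true) => //=.
apply: (replace_at (k := 3) (separate 0 false)) => //=.
apply: (replace_at (k := 2) (destabilise 1 true)) => //=.
exact: nested_circles.
Qed.

(** After the last two crossings have cancelled, the last strand closes up to a
    circle inside the two others; it is pulled out to the far left. *)
Lemma hopf_s0_s1_s1 : unknotting_number (cl [:: sigma 0; sigma 1; sigma 1]) = 1.
Proof.
apply: unknotting_number1; last by vm_compute.
apply: (@unlinked_by1 5 1 true) => //=.
apply: (replace_at (k := 4) (separate 1 true)) => //=.
apply: (replace_at (k := 3) (swap 0 0 (Cross true) Cap)) => //=.
apply: (replace_at (k := 2) (pull_out_circle 1)) => //=.
apply: (replace_at (k := 2) (pull_out_circle 0)) => //=.
apply: (replace_at (k := 1) (swap_rev 0 1 (Cup tt) (Cup tt))) => //=.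
apply: (replace_at (k := 2) (swap_rev 0 1 Cap (Cup tt))) => //=.
apply: (replace_at (k := 3) (destabilise 0 true)) => //=.
exact: adjacent_circles.
Qed.

Lemma trefoil_and_circle_s1_s1_s1 :
  unknotting_number (cl [:: sigma 1; sigma 1; sigma 1]) = 1.
Proof.
apply: unknotting_number1; last by vm_compute.
apply: (@unlinked_by1 5 1 true) => //=.
apply: (replace_at (k := 4) (separate 1 true)) => //=.
apply: (replace_at (k := 2) (destabilise 1 true)) => //=.
exact: nested_circles.
Qed.

(** * Irregular smoothings *)

(** A closed curve without crossings: its minima and maxima cancel in pairs. *)
Lemma circle_cap0_cup1 : cl [:: cap 0; cup 1] ~> disjoint_circles 1.
Proof.
apply: (replace_at (k := 2) (swap_rev 0 0 Cap (Cup tt))) => //=.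
apply: (replace_at (k := 1) (zigzag_left 0)) => //=.
apply: (replace_at (k := 2) (zigzag_right 1)) => //=.
apply: (replace_at (k := 1) (zigzag_right 0)) => //=.
exact: replace_refl.
Qed.

Lemma circle_cap1_cup1_s0 :
  cl [:: cap 1; cup 1; sigma' 0] ~> disjoint_circles 1.
Proof.
apply: (replace_at (k := 2) (zigzag_left 1)) => //=.
apply: (replace_at (k := 3) (swap 0 0 (Cross false) Cap)) => //=.
apply: (replace_at (k := 2) (zigzag_right 1)) => //=.
apply: (replace_at (k := 1) (destabilise 0 false)) => //=.
exact: replace_refl.
Qed.

Lemma circle_s0_cap1_cup0 c :
  cl [:: (0, Cross c); cap 1; cup 0] ~> disjoint_circles 1.
Proof.
apply: (replace_at (k := 2) (swap_rev 0 0 (Cross c) (Cup tt))) => //=.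
apply: (replace_at (k := 3) (zigzag_left 1)) => //=.
apply: (replace_at (k := 3) (swap 0 0 (Cup tt) Cap)) => //=.
apply: (replace_at (k := 2) (untwist_cap 0 c)) => //=.
apply: (replace_at (k := 1) (zigzag_left 0)) => //=.
apply: (replace_at (k := 1) (zigzag_right 0)) => //=.
exact: replace_refl.
Qed.

(** A crossing on one leg of the minimum left by the smoothing is carried around
    it to the other leg, where it cancels the next crossing; a crossing of the two
    legs is a curl.  The same happens, at the minimum or at the maximum, in the
    other unknots below. *)
Lemma unknot_e0_s1_s0_s1 :
  unknotting_number (cl [:: cap 0; cup 0; sigma 1; sigma 0; sigma 1]) = 0.
Proof.
apply: unknotting_number0; apply: unlinked_by0 => //=.
apply: (replace_at (k := 4) (turn_cup_rev 0 true)) => //=.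
apply: (replace_at (k := 5) (separate 0 false)) => //=.
apply: (replace_at (k := 4) (untwist_cup 1 true)) => //=.
exact: circle_cap0_cup1.
Qed.

Lemma unknot_s0_e1_s0_s1 :
  unknotting_number (cl [:: sigma 0; cap 1; cup 1; sigma 0; sigma 1]) = 0.
Proof.
apply: unknotting_number0; apply: unlinked_by0 => //=.
apply: (replace_at (k := 5) (turn_cup 0 true)) => //=.
apply: (replace_at (k := 6) (separate 1 false)) => //=.
exact: circle_s0_cap1_cup0.
Qed.

Lemma unknot_s0_s1_e0_s1 :
  unknotting_number (cl [:: sigma 0; sigma 1; cap 0; cup 0; sigma 1]) = 0.
Proof.
apply: unknotting_number0; apply: unlinked_by0 => //=.
apply: (replace_at (k := 4) (turn_cap_rev 0 true)) => //=.
apply: (replace_at (k := 3) (separate 0 true)) => //=.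
apply: (replace_at (k := 4) (turn_cup_rev 0 true)) => //=.
exact: circle_cap1_cup1_s0.
Qed.

Lemma unknot_s0_s1_s0_e1 :
  unknotting_number (cl [:: sigma 0; sigma 1; sigma 0; cap 1; cup 1]) = 0.
Proof.
apply: unknotting_number0; apply: unlinked_by0 => //=.
apply: (replace_at (k := 5) (turn_cap 0 true)) => //=.
apply: (replace_at (k := 4) (separate 1 true)) => //=.
apply: (replace_at (k := 3) (untwist_cap 0 true)) => //=.
exact: circle_cap0_cup1.
Qed.

Lemma unknot_e1_s0_s1_s1 :
  unknotting_number (cl [:: cap 1; cup 1; sigma 0; sigma 1; sigma 1]) = 0.
Proof.
apply: unknotting_number0; apply: unlinked_by0 => //=.
apply: (replace_at (k := 4) (turn_cup 0 true)) => //=.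
apply: (replace_at (k := 5) (separate 1 false)) => //=.
apply: (replace_at (k := 4) (turn_cup_rev 0 true)) => //=.
exact: circle_cap1_cup1_s0.
Qed.

(** The trefoil which the move creates.  Changing its last crossing leaves a
    single one, which is carried around the maximum. *)
Lemma trefoil_s1_e0_s1_s1 :
  unknotting_number (cl [:: sigma 1; cap 0; cup 0; sigma 1; sigma 1]) = 1.
Proof.
apply: unknotting_number1; last by vm_compute.
apply: (@unlinked_by1 7 1 true) => //=.
apply: (replace_at (k := 6) (separate 1 true)) => //=.
apply: (replace_at (k := 3) (turn_cap_rev 0 true)) => //=.
exact: circle_s0_cap1_cup0.
Qed.

Lemma unknot_s1_s0_e1_s1 :
  unknotting_number (cl [:: sigma 1; sigma 0; cap 1; cup 1; sigma 1]) = 0.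
Proof.
apply: unknotting_number0; apply: unlinked_by0 => //=.
apply: (replace_at (k := 6) (untwist_cup 1 true)) => //=.
apply: (replace_at (k := 4) (turn_cap 0 true)) => //=.
apply: (replace_at (k := 3) (separate 1 true)) => //=.
exact: circle_cap0_cup1.
Qed.

Lemma unknot_s1_s0_s1_e1 :
  unknotting_number (cl [:: sigma 1; sigma 0; sigma 1; cap 1; cup 1]) = 0.
Proof.
apply: unknotting_number0; apply: unlinked_by0 => //=.
apply: (replace_at (k := 5) (untwist_cap 1 true)) => //=.
apply: (replace_at (k := 4) (turn_cap 0 true)) => //=.
apply: (replace_at (k := 3) (separate 1 true)) => //=.
exact: circle_cap0_cup1.
Qed.

(** * The two diagrams *)

Lemma iu_withE f D : iu_with f D =
  (\sum_(k <- [seq k <- iota 0 (size D) | is_crossing D k])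
    crossing_sign D k *
    `|(unknotting_number (f D k))%:Z - (unknotting_number (forget D))%:Z|)%R.
Proof.
by rewrite big_filter -[size D in RHS]subn0 -/(index_iota 0 (size D)) big_mkord.
Qed.

Lemma RIII_move_context u v l r : R3_block l r -> RIII_move (u ++ l ++ v) (u ++ r ++ v).
Proof. by move=> lr; exists u, v, l, r; split; first left. Qed.

Theorem theorem1p6 :
  exists D E : oriented_word,
    [/\ knot_diagram D, knot_diagram E, RIII_move D E,
        iu_plus D = iu_plus E & iu_minus D <> iu_minus E].
Proof.
pose D := closure3 true [:: sigma 0; sigma 1; sigma 0; sigma 1].
pose E := closure3 true [:: sigma 1; sigma 0; sigma 1; sigma 1].
have D_crossings : [seq k <- iota 0 (size D) | is_crossing D k] = [:: 3; 4; 5; 6] by [].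
have E_crossings : [seq k <- iota 0 (size E) | is_crossing E k] = [:: 3; 4; 5; 6] by [].
exists D, E; split=> //.
- exact: (@RIII_move_context [:: (0, Cup true); (1, Cup true); (2, Cup true)]
    [:: sigma 1; cap 2; cap 1; cap 0] _ _ (@R3_cross _ 0 true true true isT)).
- rewrite /iu_plus !iu_withE D_crossings E_crossings !big_cons !big_nil.
  rewrite -[forget D]/(cl [:: sigma 0; sigma 1; sigma 0; sigma 1]) trefoil_s0_s1_s0_s1.
  rewrite -[forget E]/(cl [:: sigma 1; sigma 0; sigma 1; sigma 1]) trefoil_s1_s0_s1_s1.
  rewrite -[regular_smoothing D 3]/(cl [:: sigma 1; sigma 0; sigma 1]).
  rewrite -[regular_smoothing D 4]/(cl [:: sigma 0; sigma 0; sigma 1]).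
  rewrite -[regular_smoothing D 5]/(cl [:: sigma 0; sigma 1; sigma 1]).
  rewrite -[regular_smoothing D 6]/(cl [:: sigma 0; sigma 1; sigma 0]).
  rewrite -[regular_smoothing E 3]/(cl [:: sigma 0; sigma 1; sigma 1]).
  rewrite -[regular_smoothing E 4]/(cl [:: sigma 1; sigma 1; sigma 1]).
  rewrite -[regular_smoothing E 5]/(cl [:: sigma 1; sigma 0; sigma 1]).
  rewrite -[regular_smoothing E 6]/(cl [:: sigma 1; sigma 0; sigma 1]).
  by rewrite hopf_s1_s0_s1 hopf_s0_s0_s1 hopf_s0_s1_s1 hopf_s0_s1_s0
    trefoil_and_circle_s1_s1_s1.
- rewrite /iu_minus !iu_withE D_crossings E_crossings !big_cons !big_nil.
  rewrite -[forget D]/(cl [:: sigma 0; sigma 1; sigma 0; sigma 1]) trefoil_s0_s1_s0_s1.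
  rewrite -[forget E]/(cl [:: sigma 1; sigma 0; sigma 1; sigma 1]) trefoil_s1_s0_s1_s1.
  rewrite -[irregular_smoothing D 3]/(cl [:: cap 0; cup 0; sigma 1; sigma 0; sigma 1])
    unknot_e0_s1_s0_s1.
  rewrite -[irregular_smoothing D 4]/(cl [:: sigma 0; cap 1; cup 1; sigma 0; sigma 1])
    unknot_s0_e1_s0_s1.
  rewrite -[irregular_smoothing D 5]/(cl [:: sigma 0; sigma 1; cap 0; cup 0; sigma 1])
    unknot_s0_s1_e0_s1.
  rewrite -[irregular_smoothing D 6]/(cl [:: sigma 0; sigma 1; sigma 0; cap 1; cup 1])
    unknot_s0_s1_s0_e1.
  rewrite -[irregular_smoothing E 3]/(cl [:: cap 1; cup 1; sigma 0; sigma 1; sigma 1])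
    unknot_e1_s0_s1_s1.
  rewrite -[irregular_smoothing E 4]/(cl [:: sigma 1; cap 0; cup 0; sigma 1; sigma 1])
    trefoil_s1_e0_s1_s1.
  rewrite -[irregular_smoothing E 5]/(cl [:: sigma 1; sigma 0; cap 1; cup 1; sigma 1])
    unknot_s1_s0_e1_s1.
  rewrite -[irregular_smoothing E 6]/(cl [:: sigma 1; sigma 0; sigma 1; cap 1; cup 1])
    unknot_s1_s0_s1_e1.
  by [].
Qed.
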